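(* In the setting of the context (a Lie superalgebra $\mathfrak{g}=\mathfrak{g}_-\oplus\mathfrak{h}\oplus\mathfrak{g}_+$ satisfying assumptions (1)–(4) and a subset $\Delta_+(\mathfrak{l})\subseteq\Delta_+$ with the stated Levi property), let $\ell$ be a positive integer and let $\beta_1,\ldots,\beta_\ell\in Q_{\succ0}$. If all $\beta_i\in Q_+(\mathfrak{l})$, then $P_{\mathfrak{g},\mathfrak{l}}(\beta_1,\ldots,\beta_\ell)=0$. Suppose instead that $\beta_1,\ldots,\beta_{m-1}\in Q_+(\mathfrak{l})$ while $\beta_m\notin Q_+(\mathfrak{l})$, where $m\in\{1,\ldots,\ell\}$. Then $$P_{\mathfrak{g},\mathfrak{l}}(\beta_1,\ldots,\beta_\ell)=\sum_{k=0}^{m-1}E(\beta_1,\ldots,\beta_k)\,P_{\mathfrak{g}}(\beta_{k+1},\ldots,\beta_\ell)^{\beta_1+\cdots+\beta_k}$$ $$=\sum_{k=0}^{m-1}(-1)^{\ell-k}\,\psi_{\beta_1+\cdots+\beta_k}\,\psi_{\beta_2+\cdots+\beta_k}^{\beta_1}\cdots\psi_{\beta_k}^{\beta_1+\cdots+\beta_{k-1}}\cdot\psi_{\beta_{k+1}}^{\beta_1+\cdots+\beta_k}\,\psi_{\beta_{k+1}+\beta_{k+2}}^{\beta_1+\cdots+\beta_k}\cdots\psi_{\beta_{k+1}+\cdots+\beta_\ell}^{\beta_1+\cdots+\beta_k},$$ where for $k=0$ one has $E(\emptyset)=1$ and the first group of $\psi$-factors is the empty product $1$.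
   Context: Setting. $\mathbb{F}$ is a field of characteristic $0$; $\mathfrak{g}$ is a (not necessarily finite-dimensional) Lie superalgebra over $\mathbb{F}$ with a vector superspace decomposition into three subalgebras $\mathfrak{g}=\mathfrak{g}_-\oplus\mathfrak{h}\oplus\mathfrak{g}_+$ such that: (1) $\mathfrak{h}=\mathfrak{h}_{\bar0}$ (purely even) and $\mathfrak{h}$ is maximal abelian in $\mathfrak{g}$; (2) $\mathfrak{g}_+$ and $\mathfrak{g}_-$ have bases $\{e^i_\beta\}_{\beta\in\Delta_+,i\in I_\beta}$ and $\{f^i_\beta\}_{\beta\in\Delta_+,i\in I_\beta}$ of homogeneous weight vectors, where $\Delta_+\subseteq\mathfrak{h}^\ast$ and the $I_\beta$ are index sets: $[h,e^i_\beta]=\beta(h)e^i_\beta$, $[h,f^i_\beta]=-\beta(h)f^i_\beta$ for all $h\in\mathfrak{h}$; (3) there is $\Omega_0\in U(\mathfrak{h})$ such that $\Omega=\Omega_0+\sum_{\beta\in\Delta_+}\sum_{i\in I_\beta}f^i_\beta e^i_\beta$ defines an operator on $U(\mathfrak{g})/U(\mathfrak{g})\mathfrak{g}_+$ commuting with the action of $U(\mathfrak{g})$; in particular for each $v\in U(\mathfrak{g})/U(\mathfrak{g})\mathfrak{g}_+$, $f^i_\beta e^i_\beta v$ is nonzero for at most finitely many $(\beta,i)$; (4) any element of $U(\mathfrak{g})$ commuting with $\Omega_0$ also commutes with all of $\mathfrak{h}$. Let $Q_+=\mathbb{Z}_{\ge0}\Delta_+\subseteq\mathfrak{h}^\ast$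 and $Q_{\succ0}=Q_+\setminus\{0\}$. The relation $\lambda\preceq\mu\iff\mu-\lambda\in Q_+$ is a partial order on $\mathfrak{h}^\ast$, and $\Delta_+\subseteq Q_{\succ0}$. Let $U'(\mathfrak{h})$ be the fraction field of $U(\mathfrak{h})$. For $\lambda\in\mathfrak{h}^\ast$, $\phi\mapsto\phi^\lambda$ is the unital $\mathbb{F}$-algebra automorphism of $U'(\mathfrak{h})$ determined by $h^\lambda=h+\lambda(h)$, $h\in\mathfrak{h}$. For $\lambda\in Q_{\succ0}$ the element $\Omega_0^\lambda-\Omega_0$ is nonzero, and $\psi_\lambda=\frac{1}{\Omega_0^\lambda-\Omega_0}\in U'(\mathfrak{h})$; $\psi_\lambda^\mu=(\psi_\lambda)^\mu$. Relative data. $\Delta_+(\mathfrak{l})\subseteq\Delta_+$ is a subset such that whenever $\beta_1,\ldots,\beta_k\in\Delta_+$ and $\beta_1+\cdots+\beta_k\in\mathbb{Z}_{\ge0}\Delta_+(\mathfrak{l})$, then all $\beta_i\in\Delta_+(\mathfrak{l})$. The Levi subalgebra $\mathfrak{l}$ is the span of $\mathfrak{h}$ and all $e^i_\beta,f^i_\beta$ with $\beta\in\Delta_+(\mathfrak{l})$. The Levi cone is $Q_+(\mathfrak{l})=\mathbb{Z}_{\ge0}\Delta_+(\mathfrak{l})$. Coefficients. For $\ell\ge1$ and $\beta_1,\ldots,\beta_\ell\in Q_{\succ0}$ put $$E(\beta_1,\ldots,\beta_\ell)=\psi_{\beta_1+\cdots+\beta_\ell}\,\psi^{\beta_1}_{\beta_2+\cdots+\beta_\ell}\cdots\psi^{\beta_1+\cdots+\beta_{\ell-1}}_{\beta_\ell}\in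 U'(\mathfrak{h}),$$ and $E(\emptyset)=1$. For $\ell\ge0$ and $\beta_1,\ldots,\beta_\ell\in Q_{\succ0}$ define $P_{\mathfrak{g},\mathfrak{l}}(\beta_1,\ldots,\beta_\ell)\in U'(\mathfrak{h})$ recursively: $P_{\mathfrak{g},\mathfrak{l}}(\emptyset)=1$; if $\ell>0$ and all $\beta_i\in Q_+(\mathfrak{l})$, then $P_{\mathfrak{g},\mathfrak{l}}(\beta_1,\ldots,\beta_\ell)=0$; if $\ell>0$ and at least one $\beta_i\notin Q_+(\mathfrak{l})$, then $$P_{\mathfrak{g},\mathfrak{l}}(\beta_1,\ldots,\beta_\ell)=-\sum_{k=0}^{\ell-1}P_{\mathfrak{g},\mathfrak{l}}(\beta_1,\ldots,\beta_k)\,E(\beta_{k+1},\ldots,\beta_\ell)^{\beta_1+\cdots+\beta_k}.$$ The non-relative coefficients are $P_{\mathfrak{g}}(\beta_1,\ldots,\beta_\ell)=P_{\mathfrak{g},\mathfrak{h}}(\beta_1,\ldots,\beta_\ell)$, i.e. the same definition with $\Delta_+(\mathfrak{l})$ replaced by $\emptyset$ (so $\mathfrak{l}=\mathfrak{h}$ and $Q_+(\mathfrak{l})=\{0\}$). *)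

(* Defs.v *)
From HB Require Import structures.
From mathcomp Require Import all_boot all_order all_algebra.
From mathcomp Require Import all_classical.

Set Implicit Arguments.
Unset Strict Implicit.
Unset Printing Implicit Defensive.

Import GRing.Theory.
Local Open Scope classical_set_scope.
Local Open Scope quotient_scope.
Local Open Scope ring_scope.

(* The parity of a homogeneous element is a boolean ([true] = odd), and
   [lpart p] is the homogeneous component of parity [p].  Skew-symmetry and the
   Jacobi identity are the usual ones in characteristic different from 2, 3. *)
HB.mixin Record Lmodule_isLieSuper (F : fieldType) V of GRing.Lmodule F V := {
  lpart : bool -> {pred V};
  lpart_submod : forall p, submod_closed (lpart p);
  lpart_span : forall x : V,
    exists x0 x1 : V, [/\ x0 \in lpart false, x1 \in lpart true & x = x0 + x1];
  lpart_disjoint : forall x : V,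
    x \in lpart false -> x \in lpart true -> x = 0;
  lbr : V -> V -> V;
  lbr_linearl : forall (a : F) (x y z : V),
    lbr (a *: x + y) z = a *: lbr x z + lbr y z;
  lbr_linearr : forall (a : F) (x y z : V),
    lbr x (a *: y + z) = a *: lbr x y + lbr x z;
  lbr_part : forall (p q : bool) (x y : V),
    x \in lpart p -> y \in lpart q -> lbr x y \in lpart (p (+) q);
  lbr_skew : forall (p q : bool) (x y : V),
    x \in lpart p -> y \in lpart q ->
    lbr x y = - ((-1) ^+ (p && q) *: lbr y x);
  lbr_jacobi : forall (p q : bool) (x y z : V),
    x \in lpart p -> y \in lpart q ->
    lbr x (lbr y z) = lbr (lbr x y) z + (-1) ^+ (p && q) *: lbr y (lbr x z)
}.

#[short(type="lieSuperType")]
HB.structure Definition LieSuper (F : fieldType) :=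
  {V of Lmodule_isLieSuper F V & GRing.Lmodule F V}.

Section Subspace.
Variables (F : fieldType) (V : lmodType F) (S : submodClosed V).

Record subspace := Subspace { subspace_val : V; _ : subspace_val \in S }.
HB.instance Definition _ := [isSub for subspace_val].
HB.instance Definition _ := [Choice of subspace by <:].
HB.instance Definition _ := [SubChoice_isSubLmodule of subspace by <:].

Lemma subspace_val_linear : linear subspace_val.
Proof. by move=> a x y; rewrite -[LHS]/(val _) linearP. Qed.
HB.instance Definition _ :=
  GRing.isLinear.Build F subspace V *:%R subspace_val subspace_val_linear.
End Subspace.

Record subLie (F : fieldType) (g : lieSuperType F) := SubLie {
  sublie_mod :> submodClosed g;
  sublie_graded : forall x : g, x \in sublie_mod ->
    exists x0 x1 : g,
      [/\ x0 \in sublie_mod /\ x0 \in lpart false,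
          x1 \in sublie_mod /\ x1 \in lpart true & x = x0 + x1];
  sublie_lbr : forall x y : g,
    x \in sublie_mod -> y \in sublie_mod -> lbr x y \in sublie_mod
}.

Definition lie_of (F : fieldType) (g : lieSuperType F) (S : subLie g) :=
  subspace S.

Section SubLieStructure.
Variables (F : fieldType) (g : lieSuperType F) (S : subLie g).
Local Notation T := (lie_of S).

HB.instance Definition _ := GRing.Lmodule.on T.

Definition lie_val : T -> g := @subspace_val F g S.
HB.instance Definition _ := GRing.Linear.on lie_val.
Lemma lie_valZ a x : lie_val (a *: x) = a *: lie_val x.
Proof. exact: linearZZ. Qed.
Lemma lie_valN x : lie_val (- x) = - lie_val x.
Proof. exact: (raddfN lie_val). Qed.
Lemma lie_valD x y : lie_val (x + y) = lie_val x + lie_val y.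
Proof. exact: (raddfD lie_val). Qed.
Lemma lie_val_inj : injective lie_val. Proof. exact: val_inj. Qed.
Lemma lie_valP (x : T) : lie_val x \in sublie_mod S. Proof. exact: valP. Qed.

Definition sub_lpart (p : bool) : {pred T} :=
  [pred x : T | lie_val x \in lpart p].
Definition sub_lbr (x y : T) : T :=
  @Subspace F g S _ (sublie_lbr (lie_valP x) (lie_valP y)).

Lemma sub_lpart_submod p : submod_closed (sub_lpart p).
Proof.
have [H0 H1] := @lpart_submod F g p; split; first by rewrite inE raddf0.
by move=> a x y; rewrite !inE => hx hy; rewrite linearP; exact: H1.
Qed.

Lemma sub_lpart_span (x : T) : exists x0 x1 : T,
  [/\ x0 \in sub_lpart false, x1 \in sub_lpart true & x = x0 + x1].
Proof.
have [y0 [y1 [[s0 p0] [s1 p1] E]]] := sublie_graded (lie_valP x).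
exists (@Subspace F g S _ s0 : T), (@Subspace F g S _ s1 : T); split; rewrite ?inE //.
by apply: lie_val_inj; rewrite E raddfD.
Qed.

Lemma sub_lpart_disjoint (x : T) :
  x \in sub_lpart false -> x \in sub_lpart true -> x = 0.
Proof.
rewrite !inE => p0 p1; apply: lie_val_inj.
by rewrite raddf0; exact: lpart_disjoint p0 p1.
Qed.

Lemma sub_lbr_linearl (a : F) (x y z : T) :
  sub_lbr (a *: x + y) z = a *: sub_lbr x z + sub_lbr y z.
Proof. by apply: lie_val_inj; rewrite linearP -lbr_linearl -linearP. Qed.

Lemma sub_lbr_linearr (a : F) (x y z : T) :
  sub_lbr x (a *: y + z) = a *: sub_lbr x y + sub_lbr x z.
Proof. by apply: lie_val_inj; rewrite linearP -lbr_linearr -linearP. Qed.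

Lemma sub_lbr_part (p q : bool) (x y : T) :
  x \in sub_lpart p -> y \in sub_lpart q -> sub_lbr x y \in sub_lpart (p (+) q).
Proof. by rewrite !inE; exact: lbr_part. Qed.

Lemma sub_lbr_skew (p q : bool) (x y : T) :
  x \in sub_lpart p -> y \in sub_lpart q ->
  sub_lbr x y = - ((-1) ^+ (p && q) *: sub_lbr y x).
Proof.
rewrite !inE => hx hy; apply: lie_val_inj.
by rewrite lie_valN lie_valZ; exact: (lbr_skew _ _ _ _ hx hy).
Qed.

Lemma sub_lbr_jacobi (p q : bool) (x y z : T) :
  x \in sub_lpart p -> y \in sub_lpart q ->
  sub_lbr x (sub_lbr y z) =
  sub_lbr (sub_lbr x y) z + (-1) ^+ (p && q) *: sub_lbr y (sub_lbr x z).
Proof.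
rewrite !inE => hx hy; apply: lie_val_inj.
by rewrite lie_valD lie_valZ; exact: (lbr_jacobi _ _ _ _ _ hx hy).
Qed.

HB.instance Definition _ := Lmodule_isLieSuper.Build F T
  sub_lpart_submod sub_lpart_span sub_lpart_disjoint sub_lbr_linearl
  sub_lbr_linearr sub_lbr_part sub_lbr_skew sub_lbr_jacobi.
End SubLieStructure.

Section Dual.
Variables (F : fieldType) (V : lmodType F).

Definition is_form : {pred V -> F^o} := [pred f | `[< scalar f >]].
Lemma is_form_submod : submod_closed is_form.
Proof.
split; first by apply: asboolT => a x y; rewrite /= mulr0 addr0.
move=> a f f' /asboolW hf /asboolW hf'; apply: asboolT => b x y.
rewrite !(scalrfctE, addrfctE) hf hf' !scalerDr mulrDr addrACA; congr (_ + _ + _).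
by rewrite /GRing.scale /= mulrCA.
Qed.
HB.instance Definition _ := GRing.isSubmodClosed.Build F (V -> F^o) is_form
  is_form_submod.

Definition ldual := subspace is_form.
HB.instance Definition _ := GRing.Lmodule.on ldual.
Definition ldual_fun (f : ldual) : V -> F := subspace_val f.
End Dual.
Coercion ldual_fun : ldual >-> Funclass.

Section Enveloping.
Variables (F : fieldType) (g : lieSuperType F).

Definition super_rel (A : algType F) (f : g -> A) : Prop :=
  forall (p q : bool) (x y : g), x \in lpart p -> y \in lpart q ->
  f (lbr x y) = f x * f y - (-1) ^+ (p && q) *: (f y * f x).

(* The universal enveloping algebra, given by its universal property. *)
Record enveloping := Enveloping {
  env_alg :> algType F;
  env_inj : {linear g -> env_alg};
  env_super : super_rel env_inj;
  env_univ : forall (A : algType F) (f : {linear g -> A}), super_rel f ->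
    exists phi : {lrmorphism env_alg -> A},
      (forall x, phi (env_inj x) = f x) /\
      (forall phi' : {lrmorphism env_alg -> A},
         (forall x, phi' (env_inj x) = f x) -> phi' =1 phi)
}.

Section Lift.
Variables (U : enveloping) (A : algType F) (f : {linear g -> A}).
Hypothesis hf : super_rel f.

Definition env_lift : {lrmorphism U -> A} := sval (cid (@env_univ U A f hf)).

Lemma env_liftE x : env_lift (env_inj U x) = f x.
Proof. by rewrite /env_lift; case: cid => phi [] /=. Qed.
End Lift.

Lemma env_ext (U : enveloping) (A : algType F) (phi psi : {lrmorphism U -> A}) :
  (forall x, phi (env_inj U x) = psi (env_inj U x)) -> phi =1 psi.
Proof.
move=> H.
have hf : super_rel (psi \o env_inj U).
  move=> p q x y hx hy.
  have Z a u : psi (a *: u) = a *: psi u by rewrite linearZ.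
  have D u v : psi (u - v) = psi u - psi v by rewrite raddfB.
  have M u v : psi (u * v) = psi u * psi v by rewrite rmorphM.
  by rewrite [LHS]/= (env_super U hx hy) D Z !M.
have [chi [_ Hu]] := env_univ U hf.
by move=> u; rewrite (Hu phi) // (Hu psi).
Qed.
End Enveloping.

Section EnvelopingInclusion.
Variables (F : fieldType) (g : lieSuperType F) (S : subLie g).
Variables (US : enveloping (lie_of S)) (U : enveloping g).

Lemma incl_super : super_rel (env_inj U \o @lie_val F g S).
Proof. by move=> p q x y; exact: (env_super U). Qed.

Definition env_incl : {lrmorphism US -> U} := env_lift US incl_super.
End EnvelopingInclusion.

Record fraction_field (A : nzRingType) := FractionField {
  frac_field :> fieldType;
  frac_inj : {rmorphism A -> frac_field};
  frac_injective : injective frac_inj;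
  frac_surj : forall x : frac_field,
    exists a b : A, b != 0 /\ x = frac_inj a / frac_inj b
}.

Section FractionMap.
Variables (A : nzRingType) (K : fraction_field A) (s : {rmorphism A -> A}).
Hypothesis s_inj : injective s.
Local Notation j := (@frac_inj A K).

Lemma frac_map_ex : exists t : {rmorphism K -> K}, forall a, t (j a) = j (s a).
Proof.
have j0 b : (j b == 0) = (b == 0).
  by rewrite -(inj_eq (@frac_injective A K)) raddf0.
have s0 b : (s b == 0) = (b == 0) by rewrite -[RHS](inj_eq s_inj) raddf0.
have H (x : K) : {ab : A * A | ab.2 != 0 & x = j ab.1 / j ab.2}.
  by apply: cid2; have [a [b [? ?]]] := frac_surj x; exists (a, b).
pose t (x : K) : K := let ab := s2val (H x) in j (s ab.1) / j (s ab.2).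
have tE a b : b != 0 -> t (j a / j b) = j (s a) / j (s b).
  move=> b0; rewrite /t; case: (H _) => -[c d] /= d0 E.
  apply/eqP; rewrite eqr_div ?j0 ?s0 // -!rmorphM; apply/eqP.
  congr (j (s _)); apply: (@frac_injective A K); rewrite !rmorphM.
  by apply/eqP; rewrite -eqr_div ?j0 // E.
have tj a : t (j a) = j (s a).
  by have := tE a 1 (oner_neq0 _); rewrite !rmorph1 !divr1.
have tA : zmod_morphism t.
  move=> x y; have [a [b [b0 ->]]] := frac_surj x.
  have [c [d [d0 ->]]] := frac_surj y.
  have E (u v : A) (w z : A) : w != 0 -> z != 0 ->
    j u / j w - j v / j z = j (z * u - w * v) / j (w * z).
    move=> w0 z0; rewrite -mulNr addf_div ?j0 // rmorphB !rmorphM.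
    by rewrite [j z * _]mulrC [j w * j v]mulrC mulNr.
  have bd0 : b * d != 0 by rewrite -j0 rmorphM mulf_neq0 ?j0.
  rewrite E // !tE // E ?s0 //.
  by rewrite !(rmorphB, rmorphM).
have tM : monoid_morphism t.
  split; first by rewrite -[1](rmorph1 j) tj !rmorph1.
  move=> x y; have [a [b [b0 ->]]] := frac_surj x.
  have [c [d [d0 ->]]] := frac_surj y.
  have bd0 : b * d != 0 by rewrite -j0 rmorphM mulf_neq0 ?j0.
  by rewrite mulf_div -!rmorphM !tE // !rmorphM mulf_div.
pose tA' := GRing.isZmodMorphism.Build K K t tA.
pose tM' := GRing.isMonoidMorphism.Build K K t tM.
pose t' : {rmorphism K -> K} := HB.pack t tA' tM'.
by exists t'.
Qed.

Definition frac_map : {rmorphism K -> K} := sval (cid frac_map_ex).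

Lemma frac_mapE a : frac_map (j a) = j (s a).
Proof. by rewrite /frac_map; case: cid => t /=. Qed.
End FractionMap.

Section Shift.
Variables (F : fieldType) (h : lieSuperType F).
Hypothesis h_even : forall x : h, x \in lpart false.
Hypothesis h_abelian : forall x y : h, lbr x y = 0.
Variable U : enveloping h.

Definition shift_gen (lam : ldual h) (x : h) : U :=
  env_inj U x + (lam x)%:A.

Lemma shift_gen_linear lam : linear (shift_gen lam).
Proof.
move=> a x y; rewrite /shift_gen linearP.
have -> : lam (a *: x + y) = a * lam x + lam y.
  by case: lam => f /= /asboolW hf; exact: hf.
by rewrite scalerDr scalerDl scalerA addrACA.
Qed.
HB.instance Definition _ lam :=
  GRing.isLinear.Build F h U *:%R (shift_gen lam) (shift_gen_linear lam).

Lemma shift_gen_super lam : super_rel (shift_gen lam).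
Proof.
move=> p q x y hx hy.
have z (u : h) : u \in lpart true -> shift_gen lam u = 0.
  by move=> hu; rewrite (lpart_disjoint _ (h_even u) hu) raddf0.
rewrite h_abelian raddf0.
case: p hx => hx; first by rewrite z // mul0r mulr0 scaler0 subr0.
case: q hy => hy /=; first by rewrite (z y) // mul0r mulr0 scaler0 subr0.
have := env_super U hx hy; rewrite h_abelian raddf0 /= !scale1r.
move/esym/eqP; rewrite subr_eq0 => /eqP E.
rewrite /shift_gen !mulrDl !mulrDr E -!scalerAl -!scalerAr !mul1r !mulr1.
apply/esym/eqP; rewrite subr_eq0; apply/eqP.
by rewrite scalerA [lam x * _]mulrC -scalerA addrACA [_ *: _ + lam y *: _]addrC -addrACA.
Qed.

Definition env_shift lam : {lrmorphism U -> U} :=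
  env_lift U (@shift_gen_super lam).

Lemma env_shiftE lam x :
  env_shift lam (env_inj U x) = env_inj U x + (lam x)%:A.
Proof. exact: env_liftE. Qed.

Lemma env_shiftK lam : cancel (env_shift lam) (env_shift (- lam)).
Proof.
move=> u.
rewrite -[LHS]/((env_shift (- lam) \o env_shift lam) u) -[RHS]/(idfun u).
apply: env_ext => x; rewrite [LHS]/= [RHS]/= env_shiftE.
have D v w : env_shift (- lam) (v + w) = env_shift (- lam) v + env_shift (- lam) w.
  by rewrite raddfD.
by rewrite D env_shiftE rmorph_alg -addrA -scalerDl addNr scale0r addr0.
Qed.

Variable K : fraction_field U.

Definition shift lam : {rmorphism K -> K} :=
  frac_map K (can_inj (env_shiftK lam)).

Lemma shiftE lam x :
  shift lam (frac_inj K (env_inj U x)) = frac_inj K (env_inj U x + (lam x)%:A).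
Proof. by rewrite frac_mapE -env_shiftE. Qed.

Lemma shift_scalar lam (a : F) :
  shift lam (frac_inj K a%:A) = frac_inj K a%:A.
Proof. by rewrite frac_mapE -[in RHS](rmorph_alg (env_shift lam)). Qed.

Lemma shiftK lam : cancel (shift lam) (shift (- lam)).
Proof.
move=> x; have [a [b [_ ->]]] := frac_surj x.
rewrite !fmorph_div !frac_mapE.
by congr (frac_inj K _ / frac_inj K _); exact: env_shiftK.
Qed.
End Shift.

Section Basis.
Variables (F : fieldType) (V : lmodType F) (J : choiceType).

Definition family_basis (D : set J) (v : J -> V) (S : {pred V}) : Prop :=
  [/\ forall j, D j -> v j \in S,
      forall (s : seq J) (c : J -> F), uniq s -> (forall j, j \in s -> D j) ->
        \sum_(j <- s) c j *: v j = 0 -> forall j, j \in s -> c j = 0 &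
      forall x, x \in S -> exists (s : seq J) (c : J -> F),
        (forall j, j \in s -> D j) /\ x = \sum_(j <- s) c j *: v j].
End Basis.

Definition abelian_sub (F : fieldType) (g : lieSuperType F) (S : subLie g) :=
  forall x y : g, x \in sublie_mod S -> y \in sublie_mod S -> lbr x y = 0.

(* [posroots] is Delta_+ and [mult b] is the index set I_b; the values of
   [mult], [epos] and [fneg] outside [posroots] are irrelevant. *)
Record triangular (F : fieldType) (g : lieSuperType F) := Triangular {
  gneg : subLie g;
  cartan : subLie g;
  gpos : subLie g;
  tri_span : forall x : g, exists a b c : g,
    [/\ a \in sublie_mod gneg, b \in sublie_mod cartan, c \in sublie_mod gpos
      & x = a + b + c];
  tri_direct : forall a b c : g,
    a \in sublie_mod gneg -> b \in sublie_mod cartan -> c \in sublie_mod gpos ->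
    a + b + c = 0 -> [/\ a = 0, b = 0 & c = 0];
  cartan_even : forall x : g, x \in sublie_mod cartan -> x \in lpart false;
  cartan_abelian : abelian_sub cartan;
  cartan_maximal : forall S : subLie g, abelian_sub S ->
    {subset sublie_mod cartan <= sublie_mod S} ->
    {subset sublie_mod S <= sublie_mod cartan};
  posroots : set (ldual (lie_of cartan));
  mult : ldual (lie_of cartan) -> choiceType;
  epos : forall b, mult b -> g;
  fneg : forall b, mult b -> g;
  epos_basis : family_basis [set t | posroots (tag t)]
    (fun t : {b : ldual (lie_of cartan) & mult b} => epos (tagged t))
    (sublie_mod gpos);
  fneg_basis : family_basis [set t | posroots (tag t)]
    (fun t : {b : ldual (lie_of cartan) & mult b} => fneg (tagged t))
    (sublie_mod gneg);
  epos_homog : forall b (i : mult b), posroots b ->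
    exists p, epos i \in lpart p;
  fneg_homog : forall b (i : mult b), posroots b ->
    exists p, fneg i \in lpart p;
  epos_weight : forall b (i : mult b) (h : lie_of cartan), posroots b ->
    lbr (lie_val h) (epos i) = b h *: epos i;
  fneg_weight : forall b (i : mult b) (h : lie_of cartan), posroots b ->
    lbr (lie_val h) (fneg i) = - (b h *: fneg i)
}.

Section Weights.
Variables (F : fieldType) (g : lieSuperType F) (T : triangular g).

Definition weight := ldual (lie_of (cartan T)).
HB.instance Definition _ := GRing.Lmodule.on weight.

(* lam lies in Z_{>=0} D *)
Definition cone (D : set weight) (lam : weight) : Prop :=
  exists s : seq weight, (forall b, b \in s -> D b) /\ lam = \sum_(b <- s) b.

(* Q_{>0} *)
Definition qpos (lam : weight) : Prop := cone (@posroots F g T) lam /\ lam <> 0.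

Definition wle (lam mu : weight) : Prop := cone (@posroots F g T) (mu - lam).

Definition levi_roots (D : set weight) : Prop :=
  D `<=` @posroots F g T /\
  forall s : seq weight, (forall b, b \in s -> posroots b) ->
    cone D (\sum_(b <- s) b) -> forall b, b \in s -> D b.

Lemma cartan_type_even (x : lie_of (cartan T)) : x \in lpart false.
Proof. by rewrite inE; apply: cartan_even; exact: lie_valP. Qed.

Lemma cartan_type_abelian (x y : lie_of (cartan T)) : lbr x y = 0.
Proof.
apply: lie_val_inj; rewrite raddf0.
by apply: (@cartan_abelian F g T); exact: lie_valP.
Qed.
End Weights.

Section Casimir.
Variables (F : fieldType) (g : lieSuperType F) (T : triangular g).
Variables (Ug : enveloping g) (Uh : enveloping (lie_of (cartan T))).
Variable Om0 : Uh.

(* U(g) g_+ *)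
Definition ideal_pos : {pred Ug} := [pred x | `[< exists s : seq (Ug * g),
  (forall p, p \in s -> p.2 \in sublie_mod (gpos T)) /\
  x = \sum_(p <- s) p.1 * env_inj Ug p.2 >]].

Lemma ideal_pos_zmod : zmod_closed ideal_pos.
Proof.
split; first by apply: asboolT; exists [::]; rewrite big_nil.
move=> x y /asboolW [s [hs ->]] /asboolW [s' [hs' ->]]; apply: asboolT.
exists (s ++ [seq (- p.1, p.2) | p <- s']); split.
  by move=> p; rewrite mem_cat => /orP [/hs //|/mapP [q /hs' ? ->]].
rewrite big_cat big_map /=; congr (_ + _); rewrite -sumrN.
by apply: eq_bigr => p _; rewrite mulNr.
Qed.
HB.instance Definition _ := GRing.isZmodClosed.Build Ug ideal_pos ideal_pos_zmod.

(* U(g) / U(g) g_+, with U(g) acting by [lact]. *)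
Definition verma := Quotient.quot ideal_pos.
HB.instance Definition _ := GRing.Zmodule.on verma.
HB.instance Definition _ := EqQuotient.on verma.

Definition lact (u : Ug) (v : verma) : verma := \pi_verma (u * repr v).

Lemma lactE (u x : Ug) : lact u (\pi_verma x) = \pi_verma (u * x).
Proof.
rewrite /lact; case: piP => y /eqP.
rewrite -[_ == _](@Quotient.idealrBE _ ideal_pos x y) => /asboolW [s [hs E]].
apply/esym/eqP.
rewrite -[_ == _](@Quotient.idealrBE _ ideal_pos (u * x) (u * y)).
apply: asboolT; exists [seq (u * p.1, p.2) | p <- s]; split.
  by move=> p /mapP [q /hs ? ->].
rewrite -mulrBr E big_map mulr_sumr.
by apply: eq_bigr => p _; rewrite mulrA.
Qed.

Definition root_index := {b : weight T & mult b}.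
Definition root_pairs : set root_index := [set t | posroots (tag t)].

Definition fe (t : root_index) : Ug :=
  env_inj Ug (fneg (tagged t)) * env_inj Ug (epos (tagged t)).

Definition Omega (v : verma) : verma :=
  lact (env_incl Uh Ug Om0) v + \sum_(t \in root_pairs) lact (fe t) v.

(* By the first clause the sum in [Omega], which is over a finite support by
   convention, is the intended one. *)
Definition casimir_operator : Prop :=
  (forall v : verma, finite_set (root_pairs `&` [set t | lact (fe t) v != 0])) /\
  (forall (u : Ug) (v : verma), Omega (lact u v) = lact u (Omega v)).

Definition casimir_separates : Prop := forall x : Ug,
  GRing.comm x (env_incl Uh Ug Om0) ->
  forall h : lie_of (cartan T), GRing.comm x (env_inj Ug (lie_val h)).
End Casimir.

Section Coefficients.
Variables (F : fieldType) (g : lieSuperType F) (T : triangular g).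
Variables (Uh : enveloping (lie_of (cartan T))) (K : fraction_field Uh).
Variable Om0 : Uh.
Local Notation weight := (weight T).
Local Notation om := (frac_inj K Om0).

(* phi^lam *)
Definition twist (lam : weight) (phi : K) : K :=
  shift (@cartan_type_even F g T) (@cartan_type_abelian F g T) K lam phi.

Definition psi (lam : weight) : K := (twist lam om - om)^-1.

(* With beta_{i+1} = bs`_i, this is beta_{i+1} + ... + beta_k. *)
Definition bsum (bs : seq weight) (i k : nat) : weight :=
  \sum_(i <= t < k) bs`_t.

Definition Ecoef (bs : seq weight) : K :=
  \prod_(0 <= j < size bs) twist (bsum bs 0 j) (psi (bsum bs j (size bs))).

(* [n] is a fuel argument, bounding the length of the list. *)
Fixpoint Pcoef_rec (D : set weight) (n : nat) (bs : seq weight) : K :=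
  if bs is [::] then 1
  else if `[< forall b, b \in bs -> cone D b >] then 0
  else if n is n'.+1 then
    - \sum_(0 <= k < size bs)
        Pcoef_rec D n' (take k bs) * twist (bsum bs 0 k) (Ecoef (drop k bs))
  else 0.

(* P_{g,l}, where D is Delta_+(l); [Prel_nil], [Prel_levi] and [Prel_rec] below
   are its defining equations. *)
Definition Prel (D : set weight) (bs : seq weight) : K :=
  Pcoef_rec D (size bs) bs.

(* P_g *)
Definition Pabs (bs : seq weight) : K := Prel set0 bs.

Lemma Prel_nil D : Prel D [::] = 1.
Proof. by []. Qed.

Lemma Prel_levi D bs : (0 < size bs)%N ->
  (forall b, b \in bs -> cone D b) -> Prel D bs = 0.
Proof.
by case: bs => // b bs _ H; rewrite /Prel /=; case: asboolP.
Qed.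

Lemma Pcoef_recE D n bs : (size bs <= n)%N -> Pcoef_rec D n bs = Prel D bs.
Proof.
have H m : forall n n' bs, (size bs <= m)%N -> (m <= n)%N -> (m <= n')%N ->
  Pcoef_rec D n bs = Pcoef_rec D n' bs; last first.
  by move=> le; rewrite /Prel; apply: (H (size bs)).
elim: m => [|m IH] {}n n' [|b {}bs].
- by case: n; case: n'.
- by [].
- by case: n; case: n'.
case: n n' => [|n] [|n'] //= le lt lt'; case: ifP => // _.
congr (- _); apply: eq_big_nat => k /andP [_ lek]; congr (_ * _).
apply: IH => //; case: k lek => [|k] //= lek.
by rewrite size_take (lek : (k < size bs)%N); exact: leq_trans lek le.
Qed.

Lemma Prel_rec D bs : (exists2 b, b \in bs & ~ cone D b) ->
  Prel D bs = - \sum_(0 <= k < size bs)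
    Prel D (take k bs) * twist (bsum bs 0 k) (Ecoef (drop k bs)).
Proof.
case: bs => [|b bs] [c hc nc] //; rewrite {1}/Prel /=.
case: asboolP => [H|_]; first by case: nc; exact: H.
congr (- _); apply: eq_big_nat => k /andP [_ lek]; congr (_ * _).
apply: Pcoef_recE; case: k lek => [|k] //= lek.
by rewrite size_take (lek : (k < size bs)%N).
Qed.
End Coefficients.

(* Main.v *)
Require Import Defs.
From mathcomp Require Import all_boot all_order all_algebra.
From mathcomp Require Import all_classical.
From mathcomp Require Import ring.

Set Implicit Arguments.
Unset Strict Implicit.
Unset Printing Implicit Defensive.

Import GRing.Theory.
Local Open Scope ring_scope.

(** Write x_k for Omega_0 shifted by beta_1 + ... + beta_k.  Since shifts
    compose additively, every psi factor occurring in the theorem is the inverse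
    of a difference of two nodes x_j, so that for a <= b
      E(beta_{a+1}, ..., beta_b)^{beta_1 + ... + beta_a}
        = last_prod a b = \prod_(a <= j < b) (x_b - x_j)^-1,
    and the nodes are pairwise distinct, since beta_{i+1} + ... + beta_j lies
    in Q_{>0} for i < j (antisymmetry of the order).  What remains is an identity
    about distinct elements of a field.

    The recursion for the relative coefficients says that the row
    R(n) = P_{g,l}(beta_1, ..., beta_n) satisfies
      \sum_(l <= n) R(l) * last_prod l n = last_prod 0 n if n < m, and 0 if n >= m:
    for n < m only R(0) = 1 survives, and for n >= m this is the recursion
    itself.  So R is the row (last_prod 0 k)_{k < m}, extended by zero, multiplied
    by the inverse of the unitriangular matrix last_prod.  That inverse has the
    entries first_prod a b = \prod_(a < j <= b) (x_a - x_j)^-1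
    ([sum_first_last], a telescoping sum), whence
      P_{g,l}(beta_1, ..., beta_n)
        = \sum_(k < m) last_prod 0 k * first_prod k n   for n >= m
    ([last_prod_system_sol], [Prel_closed]).  With the trivial Levi cone and
    m = 1 the same formula gives P_g(beta_1, ..., beta_n) = first_prod 0 n
    ([Pabs_closed]).  Both right-hand sides of the theorem are now this sum, the
    signs of the second coming from (x_k - x_j)^-1 = - (x_j - x_k)^-1. *)

(** * Products of inverse differences and their orthogonality *)

Section NodeProducts.
Variables (K : fieldType) (x : nat -> K).

Definition last_prod (a b : nat) : K := \prod_(a <= j < b) (x b - x j)^-1.

Definition first_prod (a b : nat) : K := \prod_(a <= j < b) (x a - x j.+1)^-1.

Lemma last_prod0 a : last_prod a a = 1.
Proof. by rewrite /last_prod big_geq. Qed.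

Lemma first_prod0 a : first_prod a a = 1.
Proof. by rewrite /first_prod big_geq. Qed.

Variable N : nat.
Hypothesis x_neq : forall i j, (i < j <= N)%N -> x j - x i != 0.

(** The partial sums of the orthogonality relation factor completely, because
    the two products entering consecutive terms differ by one factor each and
    (x b - x a) + (x a - x n.+1) = x b - x n.+1. *)
Lemma sum_first_last_partial a b n : (a <= n)%N -> (n < b <= N)%N ->
  \sum_(a <= k < n.+1) first_prod a k * last_prod k b =
  (x b - x a)^-1 * first_prod a n * last_prod n.+1 b.
Proof.
move=> le_an; rewrite -(subnKC le_an).
elim: (n - a)%N => [|d IH] /andP [lt_nb le_bN].
  rewrite addn0 in lt_nb *.
  by rewrite big_nat1 first_prod0 mul1r mulr1 {1}/last_prod big_ltn.
rewrite addnS in lt_nb *.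
have lt_nb' := ltnW lt_nb.
rewrite big_nat_recr /=; last by rewrite leqW ?leq_addr.
rewrite IH ?lt_nb' //.
have lastS : last_prod (a + d).+1 b =
    (x b - x (a + d).+1)^-1 * last_prod (a + d).+2 b.
  by rewrite {1}/last_prod big_ltn.
have firstS : first_prod a (a + d).+1 =
    first_prod a (a + d) * (x a - x (a + d).+1)^-1.
  by rewrite {1}/first_prod big_nat_recr ?leq_addr.
rewrite lastS firstS.
have ne_ba : x b - x a != 0.
  by apply: x_neq; rewrite le_bN (leq_trans _ lt_nb') // ltnS leq_addr.
have ne_bn : x b - x (a + d).+1 != 0 by apply: x_neq; rewrite le_bN lt_nb.
have ne_an : x a - x (a + d).+1 != 0.
  rewrite -opprB oppr_eq0; apply: x_neq.
  by rewrite ltnS leq_addr (leq_trans lt_nb').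
by field; rewrite ne_ba ne_bn ne_an.
Qed.

(** The last term of the sum is the negative of the factored partial sum
    of all the others. *)
Lemma sum_first_last a b : (a <= b <= N)%N ->
  \sum_(a <= k < b.+1) first_prod a k * last_prod k b = (a == b)%:R.
Proof.
case/andP; rewrite leq_eqVlt => /predU1P [-> _|].
  by rewrite big_nat1 first_prod0 last_prod0 mulr1 eqxx.
case: b => // b lt_ab le_bN; rewrite ltn_eqF // big_nat_recr ?(ltnW lt_ab) //=.
rewrite sum_first_last_partial ?ltnSn // last_prod0 !mulr1.
rewrite [first_prod a b.+1]/first_prod big_nat_recr //= -/(first_prod a b).
by rewrite -[x a - _]opprB invrN mulrN mulrC subrr.
Qed.

Lemma last_prod_system_inj (r s : nat -> K) :
  (forall n, (n <= N)%N -> \sum_(0 <= l < n.+1) r l * last_prod l n =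
                           \sum_(0 <= l < n.+1) s l * last_prod l n) ->
  forall n, (n <= N)%N -> r n = s n.
Proof.
move=> rs n; elim/ltn_ind: n => n IH le_nN.
have := rs n le_nN; rewrite !big_nat_recr //= last_prod0 !mulr1.
rewrite (eq_big_nat _ _ (F2 := fun l => s l * last_prod l n)).
  by move/addrI.
move=> l /andP [_ lt_ln]; rewrite IH //.
exact: leq_trans (ltnW lt_ln) le_nN.
Qed.

(** The system says that r times the unitriangular matrix last_prod is the row
    (last_prod 0 k) cut off at k < m; by orthogonality first_prod is the inverse
    matrix. *)
Lemma last_prod_system_sol (m : nat) (r : nat -> K) :
  (forall n, (n <= N)%N -> \sum_(0 <= l < n.+1) r l * last_prod l n =
                           if (n < m)%N then last_prod 0 n else 0) ->
  forall n, (m <= n.+1 <= N.+1)%N ->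
    r n = \sum_(0 <= k < m) last_prod 0 k * first_prod k n.
Proof.
move=> hr n /andP [le_mn le_nN].
(* The condition k <= l discards the entries below the diagonal, where
   first_prod is an empty product rather than 0. *)
pose s l := \sum_(0 <= k < m | (k <= l)%N) last_prod 0 k * first_prod k l.
rewrite (last_prod_system_inj (s := s)) //; last first.
  move=> {le_mn le_nN}n le_nN; rewrite hr //.
  transitivity (\sum_(0 <= k < m) last_prod 0 k * (k == n)%:R); last first.
    apply/esym; under eq_bigr do rewrite mulr_suml.
    rewrite (exchange_big_dep xpredT) //=.
    apply: eq_big_nat => k _.
    case: (leqP k n) => [le_kn|lt_nk].
      rewrite -(@sum_first_last k n) ?le_kn // mulr_sumr.
      rewrite (big_cat_nat (n := k)) //=; last exact: leqW.
      rewrite [X in X + _]big_nat_cond big1 ?add0r; last first.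
        by move=> l /andP [/andP [_ lt_lk]]; rewrite leqNgt lt_lk.
      rewrite [LHS]big_nat_cond [RHS]big_nat_cond.
      apply: eq_big => [l|l _]; last by rewrite mulrA.
      by case: (leqP k l) => //=; rewrite ?andbT ?andbF.
    rewrite gtn_eqF // mulr0 big_nat_cond big1 // => l.
    case/andP=> /andP [_ lt_ln] le_kl.
    by have := leq_ltn_trans le_kl lt_ln; rewrite ltnS leqNgt lt_nk.
  rewrite big_mkord; case: ifP => [lt_nm|/negbT nlt_nm].
    rewrite (bigD1 (Ordinal lt_nm)) //= eqxx mulr1 big1 ?addr0 // => k.
    by rewrite -val_eqE /= => /negbTE ->; rewrite mulr0.
  rewrite big1 // => k _; rewrite ltn_eqF ?mulr0 //.
  by rewrite (leq_trans (ltn_ord k)) // leqNgt.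
rewrite /s [LHS]big_nat_cond [RHS]big_nat_cond.
apply: eq_bigl => k; rewrite andbT; case: (ltnP k m) => // lt_km.
exact: leq_trans lt_km le_mn.
Qed.
End NodeProducts.

(** * Sums of positive weights *)

Section Weights.
Variables (F : fieldType) (g : lieSuperType F) (T : triangular g).
Local Notation weight := (weight T).
Implicit Types (bs : seq weight) (lam mu : weight).

Lemma cone0 (D : set weight) : cone D 0.
Proof. by exists [::]; rewrite big_nil. Qed.

Lemma coneD (D : set weight) lam mu : cone D lam -> cone D mu -> cone D (lam + mu).
Proof.
move=> [s [hs ->]] [t [ht ->]]; exists (s ++ t); rewrite big_cat; split=> // b.
by rewrite mem_cat => /orP [/hs|/ht].
Qed.

Lemma cone_set0 lam : cone set0 lam -> lam = 0.
Proof.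
move=> [[|b s] [hs ->]]; first by rewrite big_nil.
by have := hs b (mem_head _ _).
Qed.

Lemma bsum_add bs i j k : (i <= j <= k)%N ->
  bsum bs i j + bsum bs j k = bsum bs i k.
Proof. by case/andP=> *; rewrite /bsum [RHS](big_cat_nat (n := j)). Qed.

Lemma bsum_take bs n i j : (j <= n)%N -> bsum (take n bs) i j = bsum bs i j.
Proof.
move=> le_jn; apply: eq_big_nat => t /andP [_ lt_tj].
by rewrite nth_take // (leq_trans lt_tj).
Qed.

Lemma bsum_drop bs k i j : bsum (drop k bs) i j = bsum bs (k + i) (k + j).
Proof.
rewrite /bsum [(k + i)%N]addnC big_addn addnC addnK.
by apply: eq_big_nat => t _; rewrite nth_drop addnC.
Qed.

(** A nonempty sum of elements of Q_{>0} is nonzero: were it 0, its first term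
    would be both above and below 0. *)
Lemma bsum_qpos bs i j
  (wle_anti : forall lam mu : weight, wle lam mu -> wle mu lam -> lam = mu)
  (hbs : forall b, b \in bs -> qpos b) :
  (i < j <= size bs)%N -> qpos (bsum bs i j).
Proof.
case/andP=> lt_ij le_j.
have cone_bsum k l : (l <= size bs)%N -> cone (@posroots F g T) (bsum bs k l).
  move=> le_l; rewrite /bsum big_nat_cond; apply: big_ind => [|lam mu|t].
  - exact: cone0.
  - exact: coneD.
  - case/andP=> /andP [_ lt_tl] _.
    by case: (hbs _ (mem_nth 0 (leq_trans lt_tl le_l))).
split; first exact: cone_bsum.
rewrite /bsum big_ltn // -/(bsum bs i.+1 j) => sum0.
have [cone_i nz_i] := hbs _ (mem_nth 0 (leq_trans lt_ij le_j)).
apply: nz_i; apply: wle_anti; rewrite /wle ?sub0r ?subr0 //.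
by move/eqP: sum0; rewrite addr_eq0 => /eqP ->; rewrite opprK; exact: cone_bsum.
Qed.

End Weights.

(** * The coefficients in terms of the shifted Omega_0 *)

Section Coefficients.
Variables (F : fieldType) (g : lieSuperType F) (T : triangular g).
Local Notation weight := (weight T).
Implicit Types (bs : seq weight) (lam mu : weight).
Variables (Uh : enveloping (lie_of (cartan T))) (K : fraction_field Uh).
Variable Om0 : Uh.
Local Notation om := (frac_inj K Om0).
Local Notation psi := (psi K Om0).
Local Notation Ecoef := (Ecoef K Om0).
Local Notation Prel := (Prel K Om0).
Local Notation Pabs := (Pabs K Om0).

(** Both sides are algebra morphisms of U(h) up to passing to fractions, so it
    suffices to compare them on h, where h is sent to h + lam(h) + mu(h). *)
Lemma twist_twist lam mu (phi : K) :
  twist lam (twist mu phi) = twist (lam + mu) phi.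
Proof.
pose sh nu := env_shift (@cartan_type_even F g T) (@cartan_type_abelian F g T) Uh nu.
have env_shiftD (u : Uh) : sh lam (sh mu u) = sh (lam + mu) u.
  rewrite -[LHS]/((sh lam \o sh mu) u); apply: env_ext => x.
  have shD v w : sh lam (v + w) = sh lam v + sh lam w by rewrite /sh raddfD.
  rewrite [LHS]/= {2 3}/sh !env_shiftE shD /sh env_shiftE rmorph_alg.
  by rewrite -addrA -scalerDl.
have [a [b [_ ->]]] := frac_surj phi.
rewrite /twist /shift !fmorph_div !frac_mapE.
by congr (frac_inj K _ / frac_inj K _); exact: env_shiftD.
Qed.

Lemma twistB lam : {morph @twist F g T Uh K lam : a b / a - b}.
Proof. exact: raddfB. Qed.

Lemma twistV lam : {morph @twist F g T Uh K lam : a / a^-1}.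
Proof. exact: fmorphV. Qed.

Lemma twist_prod lam I (r : seq I) (P : pred I) (G : I -> K) :
  twist lam (\prod_(i <- r | P i) G i) = \prod_(i <- r | P i) twist lam (G i).
Proof. exact: rmorph_prod. Qed.

Lemma twist_eq0 lam (phi : K) : (twist lam phi == 0) = (phi == 0).
Proof. exact: fmorph_eq0. Qed.

Lemma twist_psi lam mu :
  twist lam (psi mu) = (twist (lam + mu) om - twist lam om)^-1.
Proof. by rewrite /psi twistV twistB twist_twist. Qed.

(** The values of Omega_0 shifted by the partial sums of bs: in terms of these
    nodes each twisted psi is the inverse of a difference. *)
Definition node (bs : seq weight) (i : nat) : K := twist (bsum bs 0 i) om.

Lemma twist_psi_node bs i j : (i <= j)%N ->
  twist (bsum bs 0 i) (psi (bsum bs i j)) = (node bs j - node bs i)^-1.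
Proof. by move=> le_ij; rewrite twist_psi bsum_add. Qed.

Lemma node_neq bs
  (psi_denom : forall lam : weight, qpos lam -> twist lam om - om != 0)
  (wle_anti : forall lam mu : weight, wle lam mu -> wle mu lam -> lam = mu)
  (hbs : forall b, b \in bs -> qpos b) i j :
  (i < j <= size bs)%N -> node bs j - node bs i != 0.
Proof.
move=> lt_ij; case/andP: (lt_ij) => /ltnW le_ij _.
rewrite /node -(@bsum_add _ _ _ bs 0 i j) // -twist_twist.
by rewrite -twistB twist_eq0; apply/psi_denom/bsum_qpos.
Qed.

Lemma node_take bs n i : (i <= n)%N -> node (take n bs) i = node bs i.
Proof. by move=> le_in; rewrite /node bsum_take. Qed.

Lemma twist_node_drop bs k i :
  twist (bsum bs 0 k) (node (drop k bs) i) = node bs (k + i).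
Proof.
by rewrite /node twist_twist bsum_drop addn0 bsum_add ?leq_addr.
Qed.

Lemma twist_first_prod lam (x : nat -> K) a b :
  twist lam (first_prod x a b) = first_prod (fun i => twist lam (x i)) a b.
Proof.
rewrite /first_prod twist_prod; apply: eq_bigr => j _.
by rewrite twistV twistB.
Qed.

Lemma twist_Ecoef_drop bs k : (k <= size bs)%N ->
  twist (bsum bs 0 k) (Ecoef (drop k bs)) = last_prod (node bs) k (size bs).
Proof.
move=> le_k; rewrite /Ecoef twist_prod size_drop.
rewrite /last_prod -[k in RHS]add0n big_addn; apply: eq_big_nat => j /andP [_ lt_j].
rewrite twist_twist !bsum_drop addn0 subnKC // bsum_add ?leq_addr //.
rewrite addnC; apply: twist_psi_node.
by rewrite addnC -leq_subRL // ltnW.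
Qed.

Lemma last_prod_take bs n k : (k <= n)%N ->
  last_prod (node (take n bs)) k n = last_prod (node bs) k n.
Proof.
move=> le_kn; apply: eq_big_nat => j /andP [_ lt_jn].
by rewrite !node_take // ltnW.
Qed.

(** The relative coefficients of the prefixes of bs solve the triangular system
    of [last_prod_system_sol]: prefixes shorter than m consist of Levi weights
    and contribute only the initial 1, all others obey the recursion. *)
Lemma Prel_closed D bs m
  (bs_neq : forall i j, (i < j <= size bs)%N -> node bs j - node bs i != 0) :
  (1 <= m <= size bs)%N ->
  (forall i : nat, (i < m.-1)%N -> cone D bs`_i) -> ~ cone D bs`_(m.-1) ->
  Prel D bs = \sum_(0 <= k < m)
    last_prod (node bs) 0 k * first_prod (node bs) k (size bs).
Proof.
move=> /andP [m_gt0 le_m] levi_lt nlevi_m.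
rewrite -{1}[bs]take_size.
apply: (last_prod_system_sol bs_neq (r := fun n => Prel D (take n bs)));
  last by rewrite leqnn leqW.
move=> n le_n.
case: ifPn => [lt_nm|].
  rewrite big_nat_recl // take0 Prel_nil mul1r big_nat_cond big1 ?addr0 //.
  move=> l /andP [/andP [_ lt_ln] _].
  have sz : size (take l.+1 bs) = l.+1 by rewrite size_takel // (leq_trans lt_ln).
  rewrite Prel_levi ?mul0r ?sz // => b /(nthP 0) [i]; rewrite sz => lt_i <-.
  rewrite nth_take //; apply: levi_lt.
  by rewrite -ltnS prednK // (leq_ltn_trans _ lt_nm) // (leq_trans lt_i).
rewrite -leqNgt => le_mn.
have sz : size (take n bs) = n by rewrite size_takel.
rewrite big_nat_recr //= last_prod0 mulr1 Prel_rec; last first.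
  exists bs`_m.-1 => //; rewrite -(@nth_take n) ?prednK //.
  by apply: mem_nth; rewrite sz prednK.
apply/eqP; rewrite subr_eq0 sz; apply/eqP.
apply: eq_big_nat => k /andP [_ lt_kn]; have le_kn := ltnW lt_kn.
by rewrite take_takel // twist_Ecoef_drop ?sz // last_prod_take.
Qed.

(** The absolute case is m = 1 for the trivial Levi cone. *)
Lemma Pabs_closed bs
  (bs_neq : forall i j, (i < j <= size bs)%N -> node bs j - node bs i != 0)
  (hbs : forall b, b \in bs -> qpos b) :
  Pabs bs = first_prod (node bs) 0 (size bs).
Proof.
case: (posnP (size bs)) => [/size0nil ->|bs_gt0].
  by rewrite first_prod0 /Pabs Prel_nil.
rewrite /Pabs (@Prel_closed _ _ 1) // ?big_nat1 ?last_prod0 ?mul1r //.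
by move/cone_set0; case: (hbs _ (mem_nth 0 bs_gt0)).
Qed.

End Coefficients.

Theorem theorem6p1 (F : fieldType) (charF0 : [pchar F] =i pred0)
    (g : lieSuperType F) (T : triangular g)
    (Ug : enveloping g) (Uh : enveloping (lie_of (cartan T)))
    (K : fraction_field Uh) (Om0 : Uh)
    (hOmega : casimir_operator Ug Om0) (hsep : casimir_separates Ug Om0)
    (wle_anti : forall lam mu : weight T, wle lam mu -> wle mu lam -> lam = mu)
    (posroots_qpos : forall b : weight T, posroots b -> qpos b)
    (psi_denom : forall lam : weight T, qpos lam ->
       twist lam (frac_inj K Om0) - frac_inj K Om0 != 0)
    (Dl : set (weight T)) (hDl : levi_roots Dl)
    (bs : seq (weight T)) (hl : (0 < size bs)%N)
    (hbs : forall b, b \in bs -> qpos b) :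
  ((forall b, b \in bs -> cone Dl b) -> Prel K Om0 Dl bs = 0) /\
  (forall m : nat, (1 <= m <= size bs)%N ->
     (forall i : nat, (i < m.-1)%N -> cone Dl bs`_i) ->
     ~ cone Dl bs`_(m.-1) ->
     Prel K Om0 Dl bs =
       \sum_(0 <= k < m)
         Ecoef K Om0 (take k bs) *
         twist (bsum bs 0 k) (Pabs K Om0 (drop k bs)) /\
     \sum_(0 <= k < m)
         Ecoef K Om0 (take k bs) *
         twist (bsum bs 0 k) (Pabs K Om0 (drop k bs)) =
       \sum_(0 <= k < m)
         (-1) ^+ (size bs - k) *
         (\prod_(0 <= j < k) twist (bsum bs 0 j) (psi K Om0 (bsum bs j k))) *
         (\prod_(k <= j < size bs)
            twist (bsum bs 0 k) (psi K Om0 (bsum bs k j.+1)))).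
Proof.
have bs_neq := node_neq psi_denom wle_anti hbs.
split=> [|m hm levi_lt nlevi_m]; first exact: Prel_levi.
have le_km k : (k < m)%N -> (k <= size bs)%N.
  by case/andP: hm => _ le_m lt_km; rewrite (leq_trans _ le_m) // ltnW.
have E_take k : (k < m)%N -> Ecoef K Om0 (take k bs) = last_prod (node K Om0 bs) 0 k.
  move=> /le_km le_k; rewrite -last_prod_take // /Ecoef size_takel //.
  by apply: eq_big_nat => j /andP [_ /ltnW le_jk]; apply: twist_psi_node.
have P_drop k : (k < m)%N -> twist (bsum bs 0 k) (Pabs K Om0 (drop k bs)) =
    first_prod (node K Om0 bs) k (size bs).
  move=> /le_km le_k.
  have hds b : b \in drop k bs -> qpos b by move/mem_drop/hbs.
  rewrite (Pabs_closed (node_neq psi_denom wle_anti hds)) // twist_first_prod.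
  rewrite /first_prod size_drop -[X in _ = \prod_(X <= _ < _) _]add0n big_addn.
  apply: eq_bigr => j _; rewrite !twist_node_drop addn0.
  by rewrite -addSn [(j.+1 + k)%N]addnC.
rewrite (Prel_closed bs_neq hm levi_lt nlevi_m).
split; apply: eq_big_nat => k /andP [_ lt_km]; rewrite E_take // P_drop //.
have -> : last_prod (node K Om0 bs) 0 k =
    \prod_(0 <= j < k) twist (bsum bs 0 j) (psi K Om0 (bsum bs j k)).
  by apply: eq_big_nat => j /andP [_ /ltnW le_jk]; rewrite twist_psi_node.
rewrite [_ ^+ _ * _]mulrC -mulrA; congr (_ * _).
rewrite -prodr_const_nat -big_split /=.
apply: eq_big_nat => j /andP [le_kj _].
by rewrite twist_psi_node ?leqW // mulN1r -invrN opprB.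
Qed.
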